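(* Let $n\ge 1$ be an integer. If $R\in Q_n$ is a (strictly) increasing function on $[-1,1]$, then $$R'(x)<\frac{9^n}{1-x^2}\,\|R\|,\qquad x\in(-1,1).$$
   Context: For a nonnegative integer $m$, $P_m$ denotes the space of all real algebraic polynomials of degree at most $m$, and $Q_m$ denotes the set of all rational functions $r=\frac pq$ with $p,q\in P_m$ ($q\not\equiv 0$) that are continuous on $[-1,1]$. The norm $\|\cdot\|=\|\cdot\|_{C[-1,1]}$ is the uniform norm on $[-1,1]$, i.e. $\|R\|=\max_{x\in[-1,1]}|R(x)|$. *)

(* Defs.v *)
From HB Require Import structures.
From mathcomp Require Import all_boot all_order all_algebra.
From mathcomp Require Import all_classical all_reals all_analysis.
Set Implicit Arguments.
Unset Strict Implicit.
Unset Printing Implicit Defensive.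
Import Order.TTheory GRing.Theory Num.Theory.
Import numFieldNormedType.Exports.
Local Open Scope classical_set_scope.
Local Open Scope ring_scope.

(* P_m: [size p] is the degree plus one, and [size 0 = 0]. *)
Definition polys_le {R : realType} (m : nat) : set {poly R} :=
  [set p | (size p <= m.+1)%N].

(* Q_m: functions that are continuous on [-1, 1] and agree there with p / q
   away from the zeros of q. At a (removable) zero of q, where [p.[x] / q.[x]]
   would be the junk value 0, the value of [f] is fixed by continuity.
   Values of [f] outside [-1, 1] are unconstrained. *)
Definition rats_le {R : realType} (m : nat) : set (R -> R) :=
  [set f : R -> R | {within `[-1, 1], continuous f} /\
    exists p q : {poly R},
      [/\ polys_le m p, polys_le m q, q != 0 &
          forall x : R, x \in `[-1, 1] -> q.[x] != 0 ->
            f x = p.[x] / q.[x]]].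

(* The norm of C[-1, 1]; the supremum is a maximum when [f] is continuous. *)
Definition unif_norm {R : realType} (f : R -> R) : R :=
  sup [set `|f x| | x in `[-1, 1]].

(* Main.v *)
Require Import Defs.
From HB Require Import structures.
From mathcomp Require Import all_boot all_order all_algebra.
From mathcomp Require Import all_classical all_reals all_analysis.
From mathcomp Require Import ring lra.
Set Implicit Arguments.
Unset Strict Implicit.
Unset Printing Implicit Defensive.
Import Order.TTheory GRing.Theory Num.Theory.
Import numFieldNormedType.Exports.
Local Open Scope classical_set_scope.
Local Open Scope ring_scope.

(** The Moebius map [s |-> (s + x) / (1 + x * s)] is an increasing bijection of
    [-1, 1] with derivative [1 - x ^+ 2] at [0], and composing with it keeps
    rational functions of degree [n] rational of degree [n]. So let [F] be [f]
    composed with this map: it is increasing with the same norm, and the claim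
    becomes [F'(0) < 9 ^+ n * unif_norm f].

    Let [W s = F s - F (- s)], which is positive and nondecreasing for
    [0 < s <= 1], with [W 1 <= 2 * unif_norm f]. The mean slope [W s / s]
    tends to [2 * F'(0)] at [0], so if the claim fails it runs from
    [9 ^+ n * W 1] or more down to [W 1], and the intermediate value theorem
    gives points [1 = t 0 > t 1 > ... > t n > 0] such that each step multiplies
    the mean slope by [6] ([steep_separated]).

    Being rational of degree [n] is an algebraic obstruction to this. The
    Loewner matrix [(f x_i - f y_j) / (x_i - y_j)] of a rational function of
    degree [n] has rank at most [n], since its numerators are given by a
    Bezoutian, of degree below [n] in each variable ([loewner_singular]). Taken
    at the [n + 1] pairs of points that correspond to [t i] and [- t j], and up
    to scaling of its rows and columns, this matrix is
    [(F (t i) - F (- t j)) / (t i + t j)]; being singular, it has a vector [c]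
    that annihilates it, and symmetrising its quadratic form at [c] gives
    [\sum_i \sum_j c i * c j * ((w i + w j) / (t i + t j)) = 0] with
    [w i = W (t i)].

    However, that symmetric form is positive definite as soon as consecutive
    mean slopes [w i / t i], and consecutive products [w i * t i], are
    sufficiently far apart ([symLoewner_gt0]). The reason is that Gaussian
    elimination of the first variable yields a form of the same shape, whose
    slopes and products remain almost as well separated; the total loss over
    all eliminations is a convergent geometric series. A ratio of [6] between
    consecutive terms is enough, so the constant [9] leaves room. *)

(** * Positive definiteness of a symmetrised Loewner form *)

(** The ratio required between terms [i] and [i.+1]. One elimination step turns
    the pair [(i.+1, i.+2)] into the pair [(i, i.+1)] and weakens its ratio by
    the factor [1 - 3 ^- i.+1], so the requirement has to grow with [i]; this
    choice satisfies that recurrence ([gapS]) with values between [3] and [6].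
    *)
Definition gap {R : realFieldType} (i : nat) : R := 6 - 3 / 3 ^+ i.

(** Both inequalities are ratio bounds, cleared of denominators: the slopes
    [w i / s i] increase, and the products [w i * s i] decrease, by a factor of
    at least [gap i]. *)
Definition separated {R : realFieldType} (N : nat) (s w : nat -> R) : Prop :=
  (forall i, (i < N)%N -> 0 < s i /\ 0 < w i) /\
  (forall i, (i.+1 < N)%N ->
     gap i * (w i * s i.+1) <= w i.+1 * s i /\
     gap i * (w i.+1 * s i.+1) <= w i * s i).

Lemma gap_ge3 {R : realFieldType} i : 3 <= gap i :> R.
Proof.
rewrite /gap lerBrDr -lerBrDl ler_pdivrMr ?exprn_gt0//.
have : 1 <= 3 ^+ i :> R by rewrite exprn_ege1//; lra.
lra.
Qed.

Lemma gapS {R : realFieldType} i :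
  gap i <= gap i.+1 * (1 - (3 ^+ i.+1)^-1) :> R.
Proof.
rewrite /gap exprS invfM.
have : 0 < (3 ^+ i)^-1 :> R by rewrite invr_gt0 exprn_gt0.
move: ((3 ^+ i)^-1) => u u0; nra.
Qed.

Lemma separated_decay {R : realFieldType} N (s w : nat -> R) i :
  separated N s w -> (i < N)%N ->
  3 ^+ i * (w 0 * s i) <= w i * s 0 /\ 3 ^+ i * (w i * s i) <= w 0 * s 0.
Proof.
move=> [pos sep]; elim: i => [|i IH] iN; first by rewrite expr0 !mul1r; split.
have [IHg IHh] := IH (ltnW iN).
have [si wi] := pos _ (ltnW iN); have [s1 w1] := pos _ iN.
have [s0 w0] := pos 0 (leq_ltn_trans (leq0n _) iN).
have [sg sh] := sep _ iN.
have g3 : 3 <= gap i :> R := gap_ge3 i.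
have K : 0 < 3 ^+ i :> R by rewrite exprn_gt0.
rewrite exprS; move: (3 ^+ i) K IHg IHh => K K0 IHg IHh.
have sg' : 3 * (w i * s i.+1) <= w i.+1 * s i.
  by apply: le_trans sg; rewrite ler_wpM2r// mulr_ge0// ltW.
have sh' : 3 * (w i.+1 * s i.+1) <= w i * s i.
  by apply: le_trans sh; rewrite ler_wpM2r// mulr_ge0// ltW.
split.
- rewrite -(ler_pM2r (mulr_gt0 si wi)).
  have -> : 3 * K * (w 0 * s i.+1) * (s i * w i)
    = (K * (w 0 * s i)) * (3 * (w i * s i.+1)) by ring.
  have -> : w i.+1 * s 0 * (s i * w i) = (w i * s 0) * (w i.+1 * s i) by ring.
  by apply: ler_pM => //; rewrite !mulr_ge0// ltW.
- apply: le_trans IHh.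
  have -> : 3 * K * (w i.+1 * s i.+1) = K * (3 * (w i.+1 * s i.+1)) by ring.
  by rewrite ler_pM2l.
Qed.

(** Data of the form that is left after the variable [0] is eliminated from
    [symLoewner]: [elimw] replaces [w], and [elimc] rescales the variables. *)
Definition elimw {R : realFieldType} (s w : nat -> R) (i : nat) : R :=
  w 0 * (w 0 * s 0 - w i.+1 * s i.+1) / (w i.+1 * s 0 - w 0 * s i.+1).
Definition elimc {R : realFieldType} (s w : nat -> R) (i : nat) : R :=
  (w i.+1 * s 0 - w 0 * s i.+1) / (w 0 * (s i.+1 + s 0)).

Lemma separated_elim_gt0 {R : realFieldType} N (s w : nat -> R) i :
  separated N.+1 s w -> (i < N)%N ->
  0 < w i.+1 * s 0 - w 0 * s i.+1 /\ 0 < w 0 * s 0 - w i.+1 * s i.+1.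
Proof.
move=> sepN iN.
have [dg dh] := separated_decay sepN (iN : (i.+1 < N.+1)%N).
have [[s1 w1] [s0 w0]] := (sepN.1 _ (iN : (i.+1 < N.+1)%N), sepN.1 0 isT).
have K : 1 < 3 ^+ i.+1 :> R by rewrite exprn_egt1//; lra.
rewrite !subr_gt0; split.
- by apply: lt_le_trans dg; rewrite ltr_pMl// mulr_gt0.
- by apply: lt_le_trans dh; rewrite ltr_pMl// mulr_gt0.
Qed.

(** Elimination exchanges the two conditions: up to constants, the new slope
    is [(1 - b i) / (1 - a i)] divided by the old product, and the new product
    is the same factor divided by the old slope, where [a i] and [b i] are the
    slope of [0] over that of [i], and the product of [i] over that of [0]. Both
    numbers decrease with [i] and are at most [3 ^- i], hence the weakening of
    the ratios is one-sided: by [1 - a i] for one condition, by [1 - b i] for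
    the other. *)
Lemma separated_elim {R : realFieldType} N (s w : nat -> R) :
  separated N.+1 s w -> separated N (s \o succn) (elimw s w).
Proof.
move=> sepN; have [pos sep] := sepN; have [s0 w0] := pos 0 isT.
split=> [i iN|i iN] /=.
  have [Gi Hi] := separated_elim_gt0 sepN iN.
  by split; [exact: (pos _ _).1|rewrite /elimw divr_gt0// mulr_gt0].
have [Gi Hi] := separated_elim_gt0 sepN (ltnW iN).
have [Gj Hj] := separated_elim_gt0 sepN iN.
have [si wi] := pos i.+1 (ltnW iN : (i.+1 < N.+1)%N).
have [sj wj] := pos i.+2 (iN : (i.+2 < N.+1)%N).
have [dg dh] := separated_decay sepN (ltnW iN : (i.+1 < N.+1)%N).
have [sg sh] := sep i.+1 iN.
have gS : gap i <= gap i.+1 * (1 - (3 ^+ i.+1)^-1) :> R := gapS i.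
have g3 : 3 <= gap i.+1 :> R := gap_ge3 i.+1.
have g3' : 3 <= gap i :> R := gap_ge3 i.
set K := (3 ^+ i.+1)^-1 in gS.
have K0 : 0 < K by rewrite invr_gt0 exprn_gt0.
have dg' : w 0 * s i.+1 <= K * (w i.+1 * s 0).
  by rewrite -ler_pdivrMl ?invrK// invr_gt0 exprn_gt0.
have dh' : w i.+1 * s i.+1 <= K * (w 0 * s 0).
  by rewrite -ler_pdivrMl ?invrK// invr_gt0 exprn_gt0.
rewrite /elimw.
set G := w i.+1 * s 0 - _ in Gi *; set H := w 0 * s 0 - _ in Hi *.
set G' := w i.+2 * s 0 - _ in Gj *; set H' := w 0 * s 0 - _ in Hj *.
have G'0 : G' <= w i.+2 * s 0 by rewrite gerBl mulr_ge0// ltW.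
have H'0 : H' <= w 0 * s 0 by rewrite gerBl mulr_ge0// ltW.
have HH' : H <= H'.
  rewrite lerB//; apply: le_trans sh; rewrite ler_peMl ?mulr_ge0 ?ltW//.
  by apply: lt_le_trans g3; lra.
have GK : (1 - K) * (w i.+1 * s 0) <= G by rewrite /G; lra.
have HK : (1 - K) * (w 0 * s 0) <= H by rewrite /H; lra.
have K1 : 0 <= 1 - K.
  by move: gS g3 g3' K0 => ? ? ? ?; nra.
split.
- have -> : gap i * (w 0 * H / G * s i.+2) = gap i * w 0 * H * s i.+2 / G by ring.
  have -> : w 0 * H' / G' * s i.+1 = w 0 * H' * s i.+1 / G' by ring.
  rewrite ler_pdivrMr// [leRHS]mulrAC ler_pdivlMr//.
  have -> : gap i * w 0 * H * s i.+2 * G' = w 0 * (H * (gap i * (s i.+2 * G'))) by ring.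
  have -> : w 0 * H' * s i.+1 * G = w 0 * (H' * (s i.+1 * G)) by ring.
  rewrite ler_pM2l// ler_pM ?(ltW Hi) ?mulr_ge0 ?(ltW sj) ?(ltW Gj)//; first lra.
  apply: (@le_trans _ _ (gap i.+1 * (1 - K) * (s i.+2 * (w i.+2 * s 0)))).
    by apply: ler_pM => //; rewrite ?mulr_ge0 ?(ltW sj) ?(ltW Gj) ?ler_pM2l//; lra.
  have -> : gap i.+1 * (1 - K) * (s i.+2 * (w i.+2 * s 0))
    = (1 - K) * s 0 * (gap i.+1 * (w i.+2 * s i.+2)) by ring.
  apply: (@le_trans _ _ ((1 - K) * s 0 * (w i.+1 * s i.+1))).
    by rewrite ler_wpM2l// mulr_ge0// ltW.
  have -> : (1 - K) * s 0 * (w i.+1 * s i.+1)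
    = s i.+1 * ((1 - K) * (w i.+1 * s 0)) by ring.
  by rewrite ler_pM2l.
- have -> : gap i * (w 0 * H' / G' * s i.+2) = gap i * w 0 * H' * s i.+2 / G' by ring.
  have -> : w 0 * H / G * s i.+1 = w 0 * H * s i.+1 / G by ring.
  rewrite ler_pdivrMr// [leRHS]mulrAC ler_pdivlMr//.
  have -> : gap i * w 0 * H' * s i.+2 * G = w 0 * (gap i * (s i.+2 * G) * H') by ring.
  have -> : w 0 * H * s i.+1 * G' = w 0 * (s i.+1 * G' * H) by ring.
  rewrite ler_pM2l//.
  apply: (@le_trans _ _ (gap i * (s i.+2 * G) * (w 0 * s 0))).
    by rewrite ler_wpM2l// !mulr_ge0 ?(ltW sj) ?(ltW Gi)//; lra.
  apply: (@le_trans _ _ (s i.+1 * G' * ((1 - K) * (w 0 * s 0)))); last first.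
    by rewrite ler_wpM2l// mulr_ge0 ?(ltW si) ?(ltW Gj).
  rewrite !mulrA ler_pM2r// ler_pM2r// -!mulrA.
  apply: (@le_trans _ _ (gap i.+1 * (1 - K) * (s i.+2 * G))).
    by rewrite ler_wpM2r// mulr_ge0 ?(ltW sj) ?(ltW Gi).
  have -> : gap i.+1 * (1 - K) * (s i.+2 * G)
    = (gap i.+1 * (s i.+2 * G)) * (1 - K) by ring.
  rewrite [leRHS]mulrA ler_wpM2r// /G /G'.
  have -> : gap i.+1 * (s i.+2 * (w i.+1 * s 0 - w 0 * s i.+1))
    = (gap i.+1 * (w i.+1 * s i.+2)) * s 0 - gap i.+1 * (w 0 * s i.+1 * s i.+2) by ring.
  have -> : s i.+1 * (w i.+2 * s 0 - w 0 * s i.+2)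
    = (w i.+2 * s i.+1) * s 0 - w 0 * s i.+1 * s i.+2 by ring.
  rewrite lerB ?ler_pM2r// ler_peMl ?mulr_ge0 ?(ltW sj) ?(ltW si) ?(ltW w0)//.
  lra.
Qed.

(** Twice the quadratic form at [c] of any Loewner matrix
    [(F (s i) - F (- s j)) / (s i + s j)] with [w i = F (s i) - F (- s i)]. *)
Definition symLoewner {R : realFieldType} N (s w c : nat -> R) : R :=
  \sum_(i < N) \sum_(j < N) c i * c j * ((w i + w j) / (s i + s j)).

(** Completion of the square. The matrix [X] of the form solves
    [D X + X D = w 1^T + 1 w^T] with [D] diagonal; an equation of this kind
    passes to Schur complements with updated [w] and [1], and rescaling the
    variables turns the updated [1] back into the constant vector. *)
Lemma symLoewner_elim {R : realFieldType} N (s w c : nat -> R) :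
  separated N.+1 s w ->
  symLoewner N.+1 s w c =
    w 0 / s 0 * (c 0 + \sum_(i < N)
       c i.+1 * (s 0 * (w i.+1 + w 0) / (w 0 * (s i.+1 + s 0)))) ^+ 2
    + symLoewner N (s \o succn) (elimw s w)
        (fun i => elimc s w i * c i.+1).
Proof.
move=> sepN; have [pos _] := sepN; have [s0 w0] := pos 0 isT.
rewrite /symLoewner big_ord_recl /= big_ord_recl /=.
set e := fun i => s 0 * (w i.+1 + w 0) / (w 0 * (s i.+1 + s 0)).
set S := \sum_(i < N) c i.+1 * e i.
have -> : \sum_(i < N) c 0 * c (bump 0 i) * ((w 0 + w (bump 0 i)) / (s 0 + s (bump 0 i)))
    = w 0 / s 0 * c 0 * S.
  rewrite mulr_sumr; apply: eq_bigr => i _; rewrite /e /bump /= add1n.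
  have [si wi] := pos i.+1 (ltn_ord i : (i.+1 < N.+1)%N).
  by field; rewrite !gt_eqF ?addr_gt0 ?mulr_gt0.
have -> : \sum_(i < N) \sum_(j < N.+1) c (bump 0 i) * c j * ((w (bump 0 i) + w j) / (s (bump 0 i) + s j))
  = w 0 / s 0 * c 0 * S +
    \sum_(i < N) \sum_(j < N) c i.+1 * c j.+1 * ((w i.+1 + w j.+1) / (s i.+1 + s j.+1)).
  rewrite mulr_sumr -big_split/=; apply: eq_bigr => i _.
  rewrite big_ord_recl /= /bump /= add1n; congr (_ + _).
  rewrite /e; have [si wi] := pos i.+1 (ltn_ord i : (i.+1 < N.+1)%N).
  by field; rewrite !gt_eqF ?addr_gt0 ?mulr_gt0.
have SS : w 0 / s 0 * S ^+ 2
    = \sum_(i < N) \sum_(j < N) w 0 / s 0 * (c i.+1 * e i * (c j.+1 * e j)).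
  rewrite expr2 mulr_suml mulr_sumr; apply: eq_bigr => i _.
  by rewrite mulr_sumr mulr_sumr.
have E : \sum_(i < N) \sum_(j < N) c i.+1 * c j.+1 * ((w i.+1 + w j.+1) / (s i.+1 + s j.+1))
  = w 0 / s 0 * S ^+ 2 + \sum_(i < N) \sum_(j < N)
    elimc s w i * c i.+1 * (elimc s w j * c j.+1) *
      ((elimw s w i + elimw s w j) / (s i.+1 + s j.+1)).
  rewrite SS -big_split/=; apply: eq_bigr => i _.
  rewrite -big_split/=; apply: eq_bigr => j _.
  have [si wi] := pos i.+1 (ltn_ord i : (i.+1 < N.+1)%N).
  have [sj wj] := pos j.+1 (ltn_ord j : (j.+1 < N.+1)%N).
  have [Gi _] := separated_elim_gt0 sepN (ltn_ord i).
  have [Gj _] := separated_elim_gt0 sepN (ltn_ord j).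
  rewrite /e /elimw /elimc; field.
  rewrite (gt_eqF Gi) (gt_eqF Gj) !gt_eqF//; exact: addr_gt0.
rewrite E.
have -> : w 0 / s 0 * (c 0 + S) ^+ 2 = w 0 / s 0 * c 0 ^+ 2
   + 2 * (w 0 / s 0 * c 0 * S) + w 0 / s 0 * S ^+ 2 by ring.
have -> : c 0 * c 0 * ((w 0 + w 0) / (s 0 + s 0)) = w 0 / s 0 * c 0 ^+ 2.
  by field; rewrite !gt_eqF ?addr_gt0.
ring.
Qed.

Lemma symLoewner_gt0 {R : realFieldType} N (s w c : nat -> R) :
  separated N s w -> (exists2 i, (i < N)%N & c i != 0) ->
  0 < symLoewner N s w c.
Proof.
elim: N s w c => [|N IH] s w c sepN [k kN ck]; first by rewrite ltn0 in kN.
have [s0 w0] := sepN.1 0 isT.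
rewrite symLoewner_elim//.
have [cz|] := boolP [forall i : 'I_N, c i.+1 == 0].
  have cz' i : (i < N)%N -> c i.+1 = 0.
    by move=> iN; apply/eqP; have /forallP /(_ (Ordinal iN)) := cz.
  case: k kN ck => [|k] kN ck; last by rewrite cz'// eqxx in ck.
  rewrite big1 ?addr0; last by move=> i _; rewrite cz'// mul0r.
  rewrite [X in _ + X]big1 ?addr0; last first.
    by move=> i _; rewrite big1// => j _; rewrite cz'// mulr0 !mul0r.
  by rewrite mulr_gt0 ?divr_gt0// exprn_even_gt0.
rewrite negb_forall => /existsP[i ci].
apply: ltr_wpDl; first by rewrite mulr_ge0 ?divr_ge0 ?sqr_ge0// ltW.
apply: IH; first exact: separated_elim.
exists i => //; rewrite mulf_neq0// /elimc gt_eqF//.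
have [Gi _] := separated_elim_gt0 sepN (ltn_ord i).
have [si wi] := sepN.1 i.+1 (ltn_ord i : (i.+1 < N.+1)%N).
by rewrite divr_gt0// mulr_gt0// addr_gt0.
Qed.

(** * Loewner matrices of rational functions are singular *)

Lemma annihilating_weights {F : fieldType} n (y : nat -> F) :
  exists d : nat -> F, (exists2 j, (j < n.+1)%N & d j != 0) /\
    forall b : {poly F}, (size b <= n)%N ->
      \sum_(j < n.+1) d j * b.[y j] = 0.
Proof.
pose V : 'M[F]_(n.+1, n) := \matrix_(j, k) y j ^+ k.
pose v := nz_row (kermx V).
have v0 : v != 0.
  rewrite nz_row_eq0 kermx_eq0 /row_free neq_ltn.
  by rewrite (leq_ltn_trans (rank_leq_col V) (ltnSn n)).
have vV : v *m V = 0 by apply/sub_kermxP; exact: nz_row_sub.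
exists (fun j => v 0 (inord j)); split.
  have /rV0Pn[j vj] := v0.
  by exists j; rewrite ?ltn_ord// inord_val.
move=> b bn; under eq_bigr do rewrite inord_val (horner_coef_wide _ bn) mulr_sumr.
rewrite exchange_big big1//= => k _.
have := congr1 (fun A : 'rV_n => A 0 k) vV; rewrite !mxE => vk.
transitivity (b`_k * \sum_j v 0 j * V j k); last by rewrite vk mulr0.
by rewrite mulr_sumr; apply: eq_bigr => j _; rewrite mxE; ring.
Qed.

(** For fixed [x], the numerator is a polynomial in [y j] that vanishes at [x],
    so each quotient is the value at [y j] of a polynomial of degree below [n].
    *)
Lemma loewner_singular {F : fieldType} n (p q : {poly F}) (y : nat -> F) :
  (size p <= n.+1)%N -> (size q <= n.+1)%N ->
  exists d : nat -> F, (exists2 j, (j < n.+1)%N & d j != 0) /\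
    forall x, (forall j, (j < n.+1)%N -> x != y j) ->
      \sum_(j < n.+1)
        d j * ((p.[x] * q.[y j] - p.[y j] * q.[x]) / (x - y j)) = 0.
Proof.
move=> pn qn; have [d [d0 dP]] := annihilating_weights n y.
exists d; split=> // x xy.
pose N := p.[x] *: q - q.[x] *: p.
have Nn : (size N <= n.+1)%N.
  rewrite (leq_trans (size_polyD _ _))// size_polyN geq_max.
  by rewrite !(leq_trans (size_scale_leq _ _)).
have /factor_theorem[b Nb] : root N x by rewrite rootE !hornerE; apply/eqP; ring.
have bn : (size b <= n)%N.
  have [->|b0] := eqVneq b 0; first by rewrite size_poly0.
  by move: Nn; rewrite Nb size_Mmonic ?monicXsubC// size_XsubC addn2.
rewrite -[RHS]oppr0 -[X in _ = - X](dP _ bn) -sumrN; apply: eq_bigr => j _.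
have xj : x - y j != 0 by rewrite subr_eq0 xy.
have -> : p.[x] * q.[y j] - p.[y j] * q.[x] = - b.[y j] * (x - y j).
  have : N.[y j] = b.[y j] * (y j - x) by rewrite Nb !hornerE.
  by rewrite !hornerE mulNr -mulrN opprB => <-; ring.
by rewrite mulfK// mulrN.
Qed.

(** * Rational functions in lowest terms *)

Lemma nonroot_between {R : realFieldType} (q : {poly R}) (l r : R) :
  q != 0 -> l < r -> exists2 x, l < x < r & q.[x] != 0.
Proof.
move=> q0 lr.
pose u (k : nat) : R := l + (r - l) / k.+2%:R.
pose rs := [seq u k | k <- iota 0 (size q)].
have uI : injective u.
  move=> i j /addrI/mulfI; rewrite subr_eq0 gt_eqF// => /(_ isT)/invr_inj/eqP.
  by rewrite eqr_nat => /eqP[].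
have : ~~ all (root q) rs.
  apply/negP => /(max_poly_roots q0); rewrite map_inj_uniq// iota_uniq.
  by rewrite size_map size_iota ltnn => /(_ isT).
rewrite -has_predC => /hasP[x /mapP[k _ ->] /= qk].
exists (u k) => //; rewrite /u ltrDl divr_gt0 ?subr_gt0//= -ltrBrDl.
by rewrite ltr_pdivrMr// ltr_pMr ?subr_gt0// ltr1n.
Qed.

(** Once the fraction is reduced, a zero of the denominator would be a pole,
    against continuity. Continuity extends [f * q = p] from the nonzeros of the
    original denominator to the whole interval. *)
Lemma rats_le_coprime {R : realType} n (f : R -> R) : rats_le n f ->
  exists p q : {poly R}, [/\ (size p <= n.+1)%N, (size q <= n.+1)%N &
    forall x, x \in `[-1, 1] -> q.[x] != 0 /\ f x = p.[x] / q.[x]].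
Proof.
move=> [fc [p [q [pn qn q0 fE]]]].
pose d := gcdp p q.
have d0 : d != 0 by rewrite gcdp_eq0 negb_and q0 orbT.
have pE : p = p %/ d * d by rewrite divpK// dvdp_gcdl.
have qE : q = q %/ d * d by rewrite divpK// dvdp_gcdr.
have cop : coprimep (q %/ d) (p %/ d).
  by rewrite coprimep_sym coprimep_div_gcd// q0 orbT.
move: pE qE cop; set p1 := p %/ d; set q1 := q %/ d => pE qE cop.
exists p1, q1; split; [exact: leq_trans (leq_divp _ _) pn|
  exact: leq_trans (leq_divp _ _) qn|].
pose h x := f x * q1.[x] - p1.[x].
have h0 x : x \in `[-1, 1] -> q.[x] != 0 -> h x = 0.
  move=> xI qx; rewrite /h fE// {1}pE qE !hornerM.
  have : q1.[x] * d.[x] != 0 by rewrite -hornerM -qE.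
  rewrite mulf_eq0 negb_or => /andP[? ?].
  by field; apply/andP.
have hz a : a \in `[-1, 1] -> h a = 0.
  move=> aI; apply/eqP/negPn/negP => ha.
  have hc : h x @[x --> within `[-1, 1] (nbhs a)] --> h a.
    apply: cvgB; [apply: cvgM|].
    - by have /subspace_continuousP := fc; exact.
    - by apply: cvg_within_filter; exact: continuous_horner.
    - by apply: cvg_within_filter; exact: continuous_horner.
  have [e /= e0 He] := cvgr_neq0 _ hc ha.
  move: aI; rewrite in_itv /= => /andP[a1 a2].
  have lr : Num.max (-1) (a - e) < Num.min 1 (a + e).
    by rewrite lt_min !gt_max; apply/andP; split; apply/andP; split; lra.
  have [x /andP[]] := nonroot_between q0 lr.
  rewrite gt_max lt_min => /andP[x1 x2] /andP[x3 x4] qx.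
  have xI : x \in `[-1, 1] by rewrite in_itv /= !ltW.
  have : h x != 0.
    by apply: He => //=; rewrite ltr_norml; apply/andP; split; lra.
  by rewrite h0// eqxx.
move=> x xI; have hx := hz _ xI.
have q1x : q1.[x] != 0.
  apply/negP => q1x; move: hx; rewrite /h (eqP q1x) mulr0 sub0r => /eqP.
  by rewrite oppr_eq0; apply/negP; apply: coprimep_root cop q1x.
split=> //; apply: (mulIf q1x); rewrite divfK//.
by apply/eqP; rewrite -subr_eq0; apply/eqP.
Qed.

(** * Points of geometrically increasing mean slope *)

Lemma slope_points {R : realType} (g : R -> R) n :
  {within `[0, 1], continuous g} -> 0 < g 1 -> 6 ^+ n * g 1 < g 0 ->
  exists t : nat -> R,
    (forall j, (j <= n)%N -> [/\ 0 < t j, t j <= 1 & g (t j) = 6 ^+ j * g 1]) /\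
    (forall j, (j < n)%N -> t j.+1 <= t j).
Proof.
move=> gc g1; elim: n => [|n IH] gn.
  by exists (fun=> 1); split=> // j; rewrite leqn0 => /eqP ->; rewrite expr0 mul1r.
have K : 0 < 6 ^+ n * g 1 by rewrite mulr_gt0// exprn_gt0.
have gn' : 6 ^+ n * g 1 < g 0 by move: gn; rewrite exprS -mulrA; lra.
have [t [tP tD]] := IH gn'.
have [tn0 tn1 gtn] := tP n (leqnn n).
have gc' : {within `[0, t n], continuous g}.
  by apply: continuous_subspaceW gc; apply: subset_itvl; rewrite bnd_simp.
have [|z] := IVT (v := 6 ^+ n.+1 * g 1) (ltW tn0) gc'.
  rewrite gtn minC maxC /Num.min /Num.max gn' exprS -mulrA.
  by move: gn; rewrite exprS -mulrA => gn; apply/andP; split; lra.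
rewrite in_itv /= => /andP[z0 ztn] gz.
have z0' : 0 < z.
  by rewrite lt_neqAle z0 andbT; apply: contraTneq gn => z0E; rewrite z0E gz ltxx.
exists (fun j => if (j <= n)%N then t j else z); split=> j.
  have [jn _|jn jn1] := leqP j n; first exact: tP.
  have -> : j = n.+1 by apply/eqP; rewrite eqn_leq jn1.
  by split=> //; apply: le_trans ztn tn1.
rewrite ltnS => jn; rewrite jn; move: jn; rewrite leq_eqVlt => /orP[/eqP ->|jn].
  by rewrite ltnn.
by rewrite jn tD.
Qed.

(** A slope that increases by [6] while [s |-> g s * s] does not increase forces
    the points to shrink by [6], so the products [g s * s * s] shrink too. *)
Lemma steep_separated {R : realType} (g : R -> R) n :
  {within `[0, 1], continuous g} -> 0 < g 1 -> 6 ^+ n * g 1 < g 0 ->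
  (forall s t, 0 < s -> t <= 1 -> s <= t -> g s * s <= g t * t) ->
  exists t : nat -> R, (forall j, (j < n.+1)%N -> 0 < t j <= 1) /\
    separated n.+1 t (fun j => g (t j) * t j).
Proof.
move=> gc g1 gn gW; have [t [tP tD]] := slope_points gc g1 gn.
have tI j : (j < n.+1)%N -> 0 < t j <= 1 by rewrite ltnS => /tP[-> ->].
exists t; split=> //; split=> [i iN|i iN].
  have [ti0 _ gti] := tP i iN.
  by rewrite ti0 gti !mulr_gt0// exprn_gt0.
have [ti0 ti1 gti] := tP i (ltnW iN); have [tj0 tj1 gtj] := tP i.+1 iN.
have gap6 : gap i <= 6 :> R by rewrite /gap gerBl divr_ge0// exprn_ge0.
have gi0 : 0 < g (t i) by rewrite gti mulr_gt0// exprn_gt0.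
have gj : g (t i.+1) = 6 * g (t i) by rewrite gti gtj exprS mulrA.
have WW : g (t i.+1) * t i.+1 <= g (t i) * t i by rewrite gW// tD.
have Wj0 : 0 < g (t i.+1) * t i.+1 by rewrite gj !mulr_gt0.
have step : 6 * t i.+1 <= t i.
  by move: WW; rewrite gj -mulrA mulrCA ler_pM2l.
split.
- apply: (@le_trans _ _ (6 * (g (t i) * t i * t i.+1))).
    by rewrite ler_wpM2r// !mulr_ge0 ?(ltW gi0) ?(ltW ti0) ?(ltW tj0).
  by rewrite gj le_eqVlt; apply/orP; left; apply/eqP; ring.
- apply: (@le_trans _ _ (6 * (g (t i.+1) * t i.+1 * t i.+1))).
    by rewrite ler_wpM2r// mulr_ge0 ?(ltW Wj0) ?(ltW tj0).
  by rewrite mulrCA ler_pM ?(ltW Wj0)// mulr_ge0 ?(ltW tj0).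
Qed.

(** * The Moebius maps of the interval *)

Definition mobius {R : realType} (x s : R) : R := (s + x) / (1 + x * s).

Lemma mobius_den_gt0 {R : realType} (x s : R) :
  x \in `]-1, 1[ -> s \in `[-1, 1] -> 0 < 1 + x * s.
Proof.
rewrite !in_itv /= => /andP[x1 x2] /andP[s1 s2].
have : `|x * s| < 1.
  rewrite normrM; apply: (@le_lt_trans _ _ `|x|).
    by rewrite ler_piMr// ler_norml s1.
  by rewrite ltr_norml x1.
by rewrite ltr_norml => /andP[]; lra.
Qed.

Lemma mobiusB {R : realType} (x s t : R) :
  x \in `]-1, 1[ -> s \in `[-1, 1] -> t \in `[-1, 1] ->
  mobius x s - mobius x t =
    (s - t) * (1 - x ^+ 2) / ((1 + x * s) * (1 + x * t)).
Proof.
move=> xI sI tI; rewrite /mobius; field.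
by rewrite !gt_eqF// mobius_den_gt0.
Qed.

Lemma mobius_lt {R : realType} (x : R) : x \in `]-1, 1[ ->
  {in `[-1, 1] &, {homo mobius x : s t / s < t}}.
Proof.
move=> xI s t sI tI st; rewrite -subr_gt0 mobiusB//.
have := xI; rewrite in_itv /= => /andP[x1 x2].
by rewrite divr_gt0 ?mulr_gt0 ?subr_gt0 ?mobius_den_gt0//; nra.
Qed.

Lemma mobius1 {R : realType} (x : R) : x \in `]-1, 1[ -> mobius x 1 = 1.
Proof.
rewrite in_itv /= => /andP[x1 x2]; rewrite /mobius mulr1 divff// gt_eqF//; lra.
Qed.

Lemma mobiusN1 {R : realType} (x : R) : x \in `]-1, 1[ -> mobius x (-1) = -1.
Proof.
rewrite in_itv /= => /andP[x1 x2]; rewrite /mobius; field.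
by rewrite gt_eqF//; lra.
Qed.

Lemma mobius_itv {R : realType} (x s : R) : x \in `]-1, 1[ ->
  s \in `[-1, 1] -> mobius x s \in `[-1, 1].
Proof.
move=> xI sI; have := sI; have := xI; rewrite !in_itv /= => /andP[x1 x2] /andP[s1 s2].
have d := mobius_den_gt0 xI sI.
by rewrite /mobius ler_pdivlMr// ler_pdivrMr//; apply/andP; split; nra.
Qed.

Lemma is_derive_mobius {R : realType} (x s : R) :
  x \in `]-1, 1[ -> s \in `[-1, 1] ->
  is_derive s 1 (mobius x) ((1 - x ^+ 2) / (1 + x * s) ^+ 2).
Proof.
move=> xI sI; have d := mobius_den_gt0 xI sI.
have d1 : is_derive s (1:R) (fun s => s + x) 1.
  by apply: is_derive_eq; rewrite addr0.
have d2 : is_derive s (1:R) (fun s => 1 + x * s) x.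
  by apply: is_derive_eq; rewrite /GRing.scale /=; ring.
have d3 := is_deriveV (f := fun s => 1 + x * s) (lt0r_neq0 d) d2.
apply: (is_derive_eq (is_deriveM d1 d3)); rewrite /GRing.scale /=; field.
by rewrite gt_eqF.
Qed.

(** * The bound on the derivative *)

Lemma is_derive_ratio {R : realType} (p q : {poly R}) (y : R) : q.[y] != 0 ->
  is_derive y 1 (fun y => p.[y] / q.[y])
    (p.[y] * (- q.[y] ^- 2 * q^`().[y]) + q.[y]^-1 * p^`().[y]).
Proof.
move=> qy; have d3 := is_deriveV (f := horner q) qy (is_derive_poly q y).
exact: is_deriveM (is_derive_poly p y) d3.
Qed.

Lemma unif_norm_ge {R : realType} (f : R -> R) (y : R) :
  {in `[-1, 1] &, {homo f : x y / x < y}} -> y \in `[-1, 1] ->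
  `|f y| <= unif_norm f.
Proof.
move=> finc yI; apply: ub_le_sup; last by exists y.
have fle : {in `[-1, 1] &, {homo f : x y / x <= y}}.
  by move=> a b aI bI; rewrite le_eqVlt => /orP[/eqP -> //|/finc/ltW]; exact.
exists (`|f (-1)| + `|f 1|) => _ [z /= zI <-].
have zI' := zI; move: zI'; rewrite in_itv /= => /andP[z1 z2].
have m1 : (-1 : R) \in `[-1, 1] by rewrite in_itv /=; lra.
have p1 : (1 : R) \in `[-1, 1] by rewrite in_itv /=; lra.
have h1 := fle _ _ m1 zI z1; have h2 := fle _ _ zI p1 z2.
rewrite ler_norml; apply/andP; split.
- have := ler_norm (- f (-1)); rewrite normrN; have := normr_ge0 (f 1); lra.
- have := ler_norm (f 1); have := normr_ge0 (f (-1)); lra.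
Qed.

(** Separated data would make the symmetrised Loewner form positive definite,
    but the annihilating vector of the Loewner matrix at [n.+1] points is a zero
    of that form. *)
Lemma not_separated {R : realType} n (p q : {poly R}) (x : R) (t : nat -> R) :
  let F s := p.[mobius x s] / q.[mobius x s] in
  (size p <= n.+1)%N -> (size q <= n.+1)%N -> x \in `]-1, 1[ ->
  (forall y, y \in `[-1, 1] -> q.[y] != 0) ->
  (forall j, (j < n.+1)%N -> 0 < t j <= 1) ->
  ~ separated n.+1 t (fun j => F (t j) - F (- t j)).
Proof.
move=> F pn qn xI qI tI sepN.
have tI1 j : (j < n.+1)%N -> t j \in `[-1, 1].
  by move=> /tI; rewrite in_itv /= => /andP[? ?]; lra.
have tI2 j : (j < n.+1)%N -> - t j \in `[-1, 1].
  by move=> /tI; rewrite in_itv /= => /andP[? ?]; lra.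
have [d [[k kn dk] dP]] :=
  loewner_singular (fun j => mobius x (- t j)) pn qn.
(* The extra factors undo the row and column scalings of the matrix that come
   from the denominators of the fraction and of the Moebius map. *)
pose c j := d j * q.[mobius x (- t j)] * (1 + x * - t j).
have ck : c k != 0.
  by rewrite !mulf_neq0// ?qI ?mobius_itv ?gt_eqF ?mobius_den_gt0// tI2.
suff : symLoewner n.+1 t (fun j => F (t j) - F (- t j)) c = 0.
  by apply/eqP; rewrite gt_eqF// symLoewner_gt0//; exists k.
pose T (i j : 'I_n.+1) := c i * c j * ((F (t i) - F (- t j)) / (t i + t j)).
have T0 : \sum_i \sum_j T i j = 0.
  apply: big1 => i _.
  have := tI1 _ (ltn_ord i) => ti.
  have xy j : (j < n.+1)%N -> mobius x (t i) != mobius x (- t j).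
    move=> jn; rewrite gt_eqF// mobius_lt ?tI2//.
    by have := tI _ jn; have := tI _ (ltn_ord i); lra.
  have := dP _ xy.
  move=> /(congr1 (fun z => c i * (1 - x ^+ 2) / (q.[mobius x (t i)] * (1 + x * t i)) * z)).
  rewrite mulr0 => {2}<-; rewrite mulr_sumr; apply: eq_bigr => j _.
  have tj := tI2 _ (ltn_ord j).
  rewrite /T mobiusB// /F /c.
  have := xI; rewrite in_itv /= => /andP[x1 x2].
  have x3 : 1 - x ^+ 2 != 0 by rewrite gt_eqF//; nra.
  have tij : t i + t j != 0.
    by rewrite gt_eqF// addr_gt0//; [case/andP: (tI _ (ltn_ord i))|case/andP: (tI _ (ltn_ord j))].
  have := qI _ (mobius_itv xI ti); have := qI _ (mobius_itv xI tj).
  have := mobius_den_gt0 xI ti; have := mobius_den_gt0 xI tj.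
  move=> /lt0r_neq0 e1 /lt0r_neq0 e2 e3 e4.
  rewrite opprK.
  field.
  by apply/and5P; split => //; apply/andP.
have -> : symLoewner n.+1 t (fun j => F (t j) - F (- t j)) c =
    \sum_i \sum_j T i j + \sum_i \sum_j T j i.
  rewrite -big_split/=; apply: eq_bigr => i _.
  rewrite -big_split/=; apply: eq_bigr => j _.
  by rewrite /T [t j + t i]addrC [c j * c i]mulrC; ring.
by rewrite [X in _ + X]exchange_big /= T0 addr0.
Qed.

Theorem corollary1 (R : realType) (n : nat) (hn : (1 <= n)%N) (f : R -> R)
    (fQ : rats_le n f)
    (fincr : {in `[-1, 1] &, {homo f : x y / x < y}})
    (x : R) (hx : x \in `]-1, 1[) :
  f^`()%classic x < 9 ^+ n / (1 - x ^+ 2) * unif_norm f.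
Proof.
have [p [q [pn qn fE]]] := rats_le_coprime fQ.
have qI y : y \in `[-1, 1] -> q.[y] != 0 by move=> /fE[].
pose r y := p.[y] / q.[y].
pose F s := r (mobius x s).
have FE s : s \in `[-1, 1] -> F s = f (mobius x s).
  by move=> sI; rewrite /F /r (fE _ (mobius_itv hx sI)).2.
have Finc : {in `[-1, 1] &, {homo F : s t / s < t}}.
  move=> s t sI tI st; rewrite !FE//.
  by apply: fincr; rewrite ?mobius_itv//; apply: mobius_lt.
have I0 : (0 : R) \in `[-1, 1] by rewrite in_itv /=; lra.
have m1 : (-1 : R) \in `[-1, 1] by rewrite in_itv /=; lra.
have p1 : (1 : R) \in `[-1, 1] by rewrite in_itv /=; lra.
have := hx; rewrite in_itv /= => /andP[x1 x2].
have xI : x \in `[-1, 1] by rewrite in_itv /= !ltW.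
have x3 : 0 < 1 - x ^+ 2 by nra.
pose dr y := p.[y] * (- q.[y] ^- 2 * q^`().[y]) + q.[y]^-1 * p^`().[y].
have -> : f^`()%classic x = dr x.
  rewrite derive1E; apply: derive_val.
  apply: near_eq_is_derive (is_derive_ratio p (qI _ xI)).
  near=> y; rewrite (fE y _).2//; apply: subset_itv_oo_cc; near: y.
  exact: near_in_itvoo.
rewrite ltNge; apply/negP => big.
pose W s := F s - F (- s).
have dF (s : R) : s \in `[-1, 1] -> exists a : R, is_derive s 1 F a.
  move=> sI; eexists; apply: (is_derive1_comp (f := r)) (is_derive_mobius hx sI).
  exact: is_derive_ratio (qI _ (mobius_itv hx sI)).
have F0 : is_derive (0 : R) 1 F (dr x * (1 - x ^+ 2)).
  have x0 : mobius x 0 = x by rewrite /mobius add0r mulr0 addr0 divr1.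
  have := is_derive_mobius hx I0.
  rewrite mulr0 addr0 expr1n divr1; apply: (is_derive1_comp (f := r)).
  by rewrite x0; exact: is_derive_ratio (qI _ xI).
have dW (s a b : R) : is_derive s 1 F a -> is_derive (- s) 1 F b -> is_derive s 1 W (a + b).
  move=> da db.
  have dN : is_derive s (1:R) -%R (-1 : R) by exact: is_deriveNid.
  have := is_deriveB da (is_derive1_comp db dN).
  by rewrite mulrN1 opprK.
have F0' : is_derive (- 0 : R) 1 F (dr x * (1 - x ^+ 2)) by rewrite oppr0.
(* [g] is the mean slope [W s / s], extended to [0] by continuity. *)
have [g [gW gc0 g0]] := (is_derive1_caratheodory _ _ _).1 (dW _ _ _ F0 F0').
have W0 : W 0 = 0 by rewrite /W oppr0 subrr.
have {}gW z : W z = g z * z by have := gW z; rewrite W0 !subr0.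
have itvN (s : R) : s \in `[-1, 1] -> - s \in `[-1, 1].
  by rewrite !in_itv /= => /andP[? ?]; lra.
have gc : {within `[0, 1], continuous g}.
  apply: continuous_in_subspaceT => z; rewrite inE /= in_itv /= => /andP[z0 z1].
  have [-> //|zn0] := eqVneq z 0.
  have zI : z \in `[-1, 1] by rewrite in_itv /=; lra.
  have [[a da] [b db]] := (dF _ zI, dF _ (itvN _ zI)).
  have Wc : {for z, continuous W}.
    apply: differentiable_continuous; apply/derivable1_diffP.
    exact: (ex_derive (is_derive := dW _ _ _ da db)).
  have : W y / y @[y --> z] --> g z.
    rewrite -[g z](mulfK zn0) -gW.
    by apply: cvgM; [exact: Wc|apply: cvgV].
  apply: cvg_trans; apply: near_eq_cvg; near=> y.
  rewrite gW mulfK//; near: y.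
  by apply: (cvgr_neq0 z); [exact: cvg_id|].
have I1 (s : R) : 0 < s <= 1 -> s \in `[-1, 1] by rewrite in_itv /= => /andP[? ?]; lra.
have Wle (s t : R) : 0 < s <= 1 -> 0 < t <= 1 -> s <= t -> W s <= W t.
  move=> sI tI; rewrite le_eqVlt => /orP[/eqP -> //|st].
  rewrite lerB// ltW// Finc ?itvN ?I1//; lra.
have Wgt0 (s : R) : 0 < s <= 1 -> 0 < W s.
  by move=> sI; rewrite subr_gt0 Finc ?itvN ?I1//; move/andP: sI => [? ?]; lra.
have W1 : W 1 = g 1 by rewrite gW mulr1.
have g1 : 0 < g 1 by rewrite -W1 Wgt0// ltr01 lexx.
have g1N : g 1 <= 2 * unif_norm f.
  rewrite -W1 /W !FE ?itvN// mobius1// mobiusN1//.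
  have := unif_norm_ge fincr p1; have := unif_norm_ge fincr m1.
  have := ler_norm (f 1); have := ler_norm (- f (-1)); rewrite normrN; lra.
have gn : 6 ^+ n * g 1 < g 0.
  rewrite g0 -mulrDl; apply: (@lt_le_trans _ _ (9 ^+ n * g 1)).
    by rewrite ltr_pM2r// ltrXn2r// ?nnegrE -?lt0n//; lra.
  have : 9 ^+ n * unif_norm f <= dr x * (1 - x ^+ 2).
    by rewrite -ler_pdivrMr// mulrAC.
  have : 9 ^+ n * g 1 <= 9 ^+ n * (2 * unif_norm f).
    by rewrite ler_pM2l// exprn_gt0.
  lra.
have gW' (s t : R) : 0 < s -> t <= 1 -> s <= t -> g s * s <= g t * t.
  by move=> s0 t1 st; rewrite -!gW Wle//; apply/andP; split=> //; lra.
have [t [tI sepN]] := steep_separated gc g1 gn gW'.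
apply: (not_separated (x := x) (t := t) pn qn hx qI tI).
congr (separated n.+1 t _): sepN.
by apply/funext => j; rewrite -gW.
Unshelve. all: by end_near.
Qed.
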